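(* Let $n\ge 2$ and let $p(z)=z^n+a_nz^{n-1}+\cdots+a_2z+a_1$, where $a_1,a_2,\ldots,a_n$ are complex numbers and $a_1\neq 0$. If $\lambda$ is a zero of $p(z)$, then $$|\lambda|\le\frac12\left(|a_n|+\cos\frac{\pi}{n}+\sqrt{\left(|a_n|-\cos\frac{\pi}{n}\right)^2+\left(1+\sqrt{\sum_{j=1}^{n-1}|a_j|^2}\right)^2-\alpha}\right),$$ where $$\alpha=\sqrt{\sum_{j=1}^{n-1}|a_j|^2}-\frac12\left(|a_{n-1}|+\sqrt{\sum_{j=1}^{n-1}|a_j|^2}\right).$$
   Context: The coefficients are indexed so that $a_j$ is the coefficient of $z^{j-1}$ for $1\le j\le n$, and the polynomial is monic of degree $n$. *)

(* Defs.v *)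
From mathcomp Require Import all_boot all_order all_algebra.
From mathcomp Require Import reals trigo.
From mathcomp Require Export complex.
Set Implicit Arguments.
Unset Strict Implicit.
Unset Printing Implicit Defensive.
Import Order.TTheory GRing.Theory Num.Theory.
Local Open Scope ring_scope.

(* The norm `|z| of R[i] takes its values in R[i] (`|z| = (normc z)%:C); the
   real-valued modulus normc is used since the bounds live in R. *)
Notation cabs := ComplexField.Normc.normc (only parsing).

(* Only the values a 1, ..., a n matter, and a j is the coefficient of
   'X^(j - 1). *)
Definition monic_of_coefs (R : realType) (n : nat) (a : nat -> R[i]) :
    {poly R[i]} :=
  'X^n + \sum_(1 <= j < n.+1) a j *: 'X^(j.-1).

(* Index n is excluded: the sum runs over 1 <= j <= n - 1. *)
Definition coef_norm (R : realType) (n : nat) (a : nat -> R[i]) : R :=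
  Num.sqrt (\sum_(1 <= j < n) cabs (a j) ^+ 2).

Definition alpha (R : realType) (n : nat) (a : nat -> R[i]) : R :=
  coef_norm n a - 2^-1 * (cabs (a n.-1) + coef_norm n a).

(* Main.v *)
Require Import Defs.
From mathcomp Require Import all_boot all_order all_algebra.
From mathcomp Require Import reals trigo.
From mathcomp Require Import ring lra.
Import Order.TTheory GRing.Theory Num.Theory.
Local Open Scope ring_scope.

(** Put r = |lambda| and n = m + 2, and let X = r^(m+1), Y^2 = the sum of
    r^(2i) over i <= m; these measure the two blocks of the eigenvector
    (lambda^(n-1), ..., lambda, 1) of the companion matrix of p.  Evaluating
    the quadratic form of the companion matrix at this eigenvector gives

      r (X^2 + Y^2) <= |a_n| X^2 + T X Y + cos (pi / n) Y^2,

    with T^2 = S^2 + 1 + 2 |a_(n-1)| and S = coef_norm n a.  Indeed: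
    - multiplying r^n <= |a_n| r^(n-1) + ... + |a_1| by X yields the first term
      and part of the second; the entry -a_(n-1) of the first row and the first
      subdiagonal 1 both pair X with r^m, so that Cauchy-Schwarz
      ([sum_mul_sqr_le]) is applied to the coefficient vector with 1 added to
      |a_(n-1)| ([sum_shift_last_sqr]);
    - the remaining subdiagonal 1's form a shift in dimension n - 1, whose
      numerical radius is cos (pi / n) ([shift_form_le_cos]).
    Hence r is at most the largest eigenvalue of the symmetric 2 x 2 matrix of
    the form on the right ([le_max_eigenvalue2]).  The announced bound follows
    since T^2 <= (1 + S)^2 - alpha, the difference being 3/2 (S - |a_(n-1)|). *)

(** * Quadratic forms *)

(** The right-hand side is the largest eigenvalue of the form with diagonal A, c
    and off-diagonal entry (sqrt D) / 2.  If r exceeded it, the form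
    (r - A) X^2 - T X Y + (r - c) Y^2 would have positive trace and negative
    discriminant, hence be positive definite. *)
Lemma le_max_eigenvalue2 {R : rcfType} {A c T D r X Y : R} :
  0 < Y -> T ^+ 2 <= D ->
  r * (X ^+ 2 + Y ^+ 2) <= A * X ^+ 2 + T * X * Y + c * Y ^+ 2 ->
  r <= 2^-1 * (A + c + Num.sqrt ((A - c) ^+ 2 + D)).
Proof.
move=> Y_gt0 TD form_le; rewrite leNgt; apply/negP => r_gt.
set q := Num.sqrt _ in r_gt.
have q_ge0 : 0 <= q by exact: sqrtr_ge0.
have q2 : q ^+ 2 = (A - c) ^+ 2 + D.
  by rewrite sqr_sqrtr// addr_ge0 ?sqr_ge0// (le_trans (sqr_ge0 T)).
pose u := r - A; pose v := r - c.
have q_lt : q < u + v by rewrite /u /v; lra.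
have disc : T ^+ 2 < 4 * (u * v).
  have : q ^+ 2 < (u + v) ^+ 2 by rewrite ltrXn2r// ltW// (le_lt_trans q_ge0).
  rewrite q2 /u /v; move: TD; clear; nra.
have uv_gt0 : 0 < u * v by have := sqr_ge0 T; lra.
have u_gt0 : 0 < u.
  rewrite ltNge; apply/negP => u_le0; have v_ge0 : 0 <= v by lra.
  by have := mulr_le0_ge0 u_le0 v_ge0; lra.
have form_le0 : u * X ^+ 2 - T * X * Y + v * Y ^+ 2 <= 0.
  by rewrite /u /v; move: form_le; clear; lra.
have : 0 < (2 * u * X - T * Y) ^+ 2 + (4 * (u * v) - T ^+ 2) * Y ^+ 2.
  by rewrite ltr_wpDl ?sqr_ge0// mulr_gt0 ?subr_gt0 ?exprn_gt0.
(* completing the square *)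
rewrite (_ : _ + _ = 4 * u * (u * X ^+ 2 - T * X * Y + v * Y ^+ 2)); last ring.
by rewrite pmulr_rgt0 ?mulr_gt0// ltNge form_le0.
Qed.

Lemma sum_mul_sqr_le {R : realDomainType} (I : Type) (s : seq I) (u v : I -> R) :
  0 < \sum_(i <- s) v i ^+ 2 ->
  (\sum_(i <- s) u i * v i) ^+ 2 <=
    (\sum_(i <- s) u i ^+ 2) * (\sum_(i <- s) v i ^+ 2).
Proof.
set U := \sum_(i <- s) u i ^+ 2; set V := \sum_(i <- s) v i ^+ 2.
set P := \sum_(i <- s) u i * v i => V_gt0.
(* up to the factor V, the squared distance from u to the line spanned by v *)
have : 0 <= \sum_(i <- s) (V * u i - P * v i) ^+ 2.
  by apply: sumr_ge0 => i _; exact: sqr_ge0.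
rewrite (_ : \sum_(i <- s) _ = V * (U * V - P ^+ 2)).
  by rewrite pmulr_rge0// subr_ge0.
rewrite (eq_bigr (fun i => V ^+ 2 * u i ^+ 2 - 2 * V * P * (u i * v i)
                           + P ^+ 2 * v i ^+ 2)); last by move=> i _; ring.
by rewrite big_split/= sumrB -!mulr_sumr -/U -/V -/P; ring.
Qed.

(** * The numerical radius of the shift *)

(** A positive supersolution s of the eigenvalue equation for the symmetrised
    shift bounds its form: weight 2 x_i x_(i+1) <= (s_(i+1) / s_i) x_i^2 +
    (s_i / s_(i+1)) x_(i+1)^2 and collect, using
    s_(i-1) + s_(i+1) = 2 c s_i. *)
Lemma shift_form_le {R : realFieldType} {m : nat} {c : R} (s x : nat -> R) :
  (forall i, (i <= m)%N -> 0 < s i) -> 0 <= s m.+1 ->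
  s 1%N = 2 * c * s 0%N ->
  (forall i, (i < m)%N -> s i + s i.+2 = 2 * c * s i.+1) ->
  \sum_(0 <= i < m) x i * x i.+1 <= c * \sum_(0 <= i < m.+1) x i ^+ 2.
Proof.
move=> s_gt0 sm_ge0 s1 s_rec.
(* the weight s_(k+1) / s_k of x_k^2 is what the next step consumes *)
have partial k : (k <= m)%N ->
    2 * \sum_(0 <= i < k) x i * x i.+1 + s k.+1 / s k * x k ^+ 2
    <= 2 * c * \sum_(0 <= i < k.+1) x i ^+ 2.
  elim: k => [_|k IH k_lt].
    rewrite big_geq// big_nat1 mulr0 add0r s1 mulfK//.
    by rewrite gt_eqF// s_gt0.
  have sk := s_gt0 k (ltnW k_lt); have sk1 := s_gt0 k.+1 k_lt.
  rewrite big_nat_recr//= [X in _ <= _ * X]big_nat_recr//=.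
  have sk2 : s k.+2 / s k.+1 = 2 * c - s k / s k.+1.
    have -> : s k.+2 = 2 * c * s k.+1 - s k by rewrite -(s_rec k k_lt); ring.
    by field; rewrite gt_eqF.
  have amgm : 2 * (x k * x k.+1) <=
      s k.+1 / s k * x k ^+ 2 + s k / s k.+1 * x k.+1 ^+ 2.
    rewrite -subr_ge0 (_ : _ - _ =
      (s k.+1 * x k - s k * x k.+1) ^+ 2 / (s k * s k.+1)).
      by rewrite divr_ge0 ?sqr_ge0// mulr_ge0 ?ltW.
    by field; rewrite !gt_eqF.
  by have := IH (ltnW k_lt); rewrite sk2; lra.
have last_ge0 : 0 <= s m.+1 / s m * x m ^+ 2.
  by rewrite mulr_ge0 ?sqr_ge0// divr_ge0// ltW// s_gt0.
by have := partial m (leqnn m); lra.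
Qed.

(** The top eigenvector of the path with m + 1 vertices is
    sin ((i + 1) pi / (m + 2)): it vanishes at both virtual end points. *)
Lemma shift_form_le_cos {R : realType} (m : nat) (x : nat -> R) :
  \sum_(0 <= i < m) x i * x i.+1 <=
    cos (pi / m.+2%:R) * \sum_(0 <= i < m.+1) x i ^+ 2.
Proof.
pose t : R := pi / m.+2%:R; rewrite -/t.
have t_gt0 : 0 < t by rewrite divr_gt0 ?pi_gt0 ?ltr0n.
have tE : m.+2%:R * t = pi by rewrite /t mulrC divfK ?pnatr_eq0.
apply: (shift_form_le (fun i => sin (i.+1%:R * t))).
- move=> i i_le; apply: sin_gt0_pi.
  by rewrite mulr_gt0 ?ltr0n//= -tE ltr_pM2r// ltr_nat.
- by rewrite tE sinpi.
- by rewrite mul1r mulr_natl mulr2n sinD; ring.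
- move=> i _; rewrite (_ : i.+1%:R * t = i.+2%:R * t - t); last first.
    by rewrite -[i.+2%:R]natr1; ring.
  rewrite (_ : i.+3%:R * t = i.+2%:R * t + t); last first.
    by rewrite -[i.+3%:R]natr1; ring.
  by rewrite sinB sinD; ring.
Qed.

(** * Moduli *)

Lemma normc_ge0 {R : rcfType} (z : R[i]) : 0 <= cabs z.
Proof. by case: z => x y; exact: sqrtr_ge0. Qed.

Lemma normcX {R : rcfType} (z : R[i]) k : cabs (z ^+ k) = cabs z ^+ k.
Proof.
elim: k => [|k IH]; first by rewrite !expr0 ComplexField.Normc.normc1.
by rewrite !exprS ComplexField.Normc.normcM IH.
Qed.

Lemma normc_sum_le {R : rcfType} (I : Type) (s : seq I) (f : I -> R[i]) :
  cabs (\sum_(i <- s) f i) <= \sum_(i <- s) cabs (f i).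
Proof.
elim: s => [|i s IH]; first by rewrite !big_nil ComplexField.Normc.normc0.
by rewrite !big_cons (le_trans (le_normcD _ _))// lerD2l.
Qed.

Lemma root_monic_of_coefs_normc {R : realType} {n : nat} {a : nat -> R[i]}
    {lambda : R[i]} :
  root (monic_of_coefs n a) lambda ->
  cabs lambda ^+ n <= \sum_(0 <= i < n) cabs (a i.+1) * cabs lambda ^+ i.
Proof.
rewrite /root /monic_of_coefs hornerD hornerXn horner_sum addr_eq0 => /eqP eqn.
rewrite -normcX eqn normcN big_add1/= (le_trans (normc_sum_le _ _ _))//.
by apply: ler_sum => i _; rewrite hornerZ hornerXn ComplexField.Normc.normcM normcX.
Qed.

(** * The bound *)

Lemma sum_shift_last_sqr {R : comPzRingType} (m : nat) (b : nat -> R) :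
  \sum_(0 <= i < m.+1) (b i + (i == m)%:R) ^+ 2 =
    \sum_(0 <= i < m.+1) b i ^+ 2 + 1 + 2 * b m.
Proof.
rewrite !big_nat_recr//= eqxx/=.
rewrite (eq_big_nat _ _ (F2 := fun i => b i ^+ 2)); first ring.
by move=> i /andP[_ i_lt]; rewrite ltn_eqF// addr0.
Qed.

(** Here A stands for |a_n| and b i for |a_(i+1)|.  In r times the sum of the
    r^(2i), the product r^(m+1) r^m of the first two eigenvector entries is
    split off and joins the terms pairing X with the lower block; only the
    products within the lower block are left to the shift. *)
Lemma companion_form_le {R : realType} {m : nat} {A r : R} {b : nat -> R} :
  0 <= r -> r ^+ m.+2 <= \sum_(0 <= i < m.+1) b i * r ^+ i + A * r ^+ m.+1 ->
  r * (r ^+ m.+1 ^+ 2 + \sum_(0 <= i < m.+1) (r ^+ i) ^+ 2) <=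
    A * r ^+ m.+1 ^+ 2
    + r ^+ m.+1 * \sum_(0 <= i < m.+1) (b i + (i == m)%:R) * r ^+ i
    + cos (pi / m.+2%:R) * \sum_(0 <= i < m.+1) (r ^+ i) ^+ 2.
Proof.
move=> r_ge0 root_le.
have X_ge0 : 0 <= r ^+ m.+1 by exact: exprn_ge0.
have shift := shift_form_le_cos m (fun i => r ^+ i).
have -> : \sum_(0 <= i < m.+1) (b i + (i == m)%:R) * r ^+ i =
    \sum_(0 <= i < m.+1) b i * r ^+ i + r ^+ m.
  rewrite !big_nat_recr//= eqxx/=.
  rewrite (eq_big_nat _ _ (F2 := fun i => b i * r ^+ i)); first ring.
  by move=> i /andP[_ i_lt]; rewrite ltn_eqF// addr0.
have Yr : r * \sum_(0 <= i < m.+1) (r ^+ i) ^+ 2 =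
    \sum_(0 <= i < m) r ^+ i * r ^+ i.+1 + r ^+ m.+1 * r ^+ m.
  rewrite mulr_sumr big_nat_recr//=; congr (_ + _); last first.
    by rewrite [r ^+ _.+1]exprS; ring.
  by apply: eq_bigr => i _; rewrite [r ^+ _.+1]exprS; ring.
have Xr := ler_wpM2l X_ge0 root_le.
rewrite mulrDr Yr (_ : r * r ^+ m.+1 ^+ 2 = r ^+ m.+1 * r ^+ m.+2); last first.
  by rewrite [r ^+ m.+2]exprS; ring.
by move: Xr shift; lra.
Qed.

Theorem theorem1p8 (R : realType) (n : nat) (a : nat -> R[i]) (lambda : R[i])
    (n_ge2 : (2 <= n)%N) (a1_neq0 : a 1%N != 0)
    (lambda_zero : root (monic_of_coefs n a) lambda) :
  cabs lambda <=
    2^-1 * (cabs (a n) + cos (pi / n%:R) +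
            Num.sqrt ((cabs (a n) - cos (pi / n%:R)) ^+ 2
                      + (1 + coef_norm n a) ^+ 2 - alpha n a)).
Proof.
case: n n_ge2 lambda_zero => [//|[//|m]] _ /root_monic_of_coefs_normc.
rewrite big_nat_recr//=; set r := cabs lambda => root_le.
have r_ge0 : 0 <= r by exact: normc_ge0.
pose b i := cabs (a i.+1); pose S := coef_norm m.+2 a.
have S2 : S ^+ 2 = \sum_(0 <= i < m.+1) b i ^+ 2.
  by rewrite sqr_sqrtr big_add1//; apply: sumr_ge0 => i _; exact: sqr_ge0.
have bm_le : b m <= S.
  rewrite -[b m]ger0_norm ?normc_ge0// -sqrtr_sqr ler_wsqrtr//.
  rewrite big_add1/= big_nat_recr//= lerDr.
  by apply: sumr_ge0 => i _; exact: sqr_ge0.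
set V : R := \sum_(0 <= i < m.+1) (r ^+ i) ^+ 2.
(* the constant coordinate of the eigenvector is 1 *)
have V_gt0 : 0 < V.
  rewrite /V big_nat_recl//= expr0 expr1n ltr_pwDl//.
  by apply: sumr_ge0 => i _; exact: sqr_ge0.
pose P := \sum_(0 <= i < m.+1) (b i + (i == m)%:R) * r ^+ i.
pose Y := Num.sqrt V.
have Y_gt0 : 0 < Y by rewrite sqrtr_gt0.
have Y2 : Y ^+ 2 = V by rewrite sqr_sqrtr// ltW.
rewrite -(addrA (_ ^+ 2)).
apply: (le_max_eigenvalue2 (X := r ^+ m.+1) (T := P / Y) Y_gt0).
  rewrite expr_div_n Y2 ler_pdivrMr//.
  apply: (le_trans (sum_mul_sqr_le _ _ _ _ V_gt0)).
  rewrite ler_pM2r// sum_shift_last_sqr -S2 /alpha/= -/S -[cabs (a m.+1)]/(b m).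
  by move: bm_le; lra.
rewrite Y2 (_ : P / Y * r ^+ m.+1 * Y = r ^+ m.+1 * P); last first.
  by field; rewrite gt_eqF.
exact: (companion_form_le r_ge0 root_le).
Qed.
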